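(* Let $(T,o)$ be a rooted directed tree and let $G$ be a finite directed graph. Choose an exponent $p_e\in[1,\infty)$ for every arc $e$ of $T$. Let $F_x:V(G)\to\mathbb R_{\ge0}$, $x\in V(T)$, be the message functions defined in the context. Then for every $v\in V(G)$ and every non-leaf $x\in V(T)$, $$F_x(v)\le\Big(\prod_{c\in\mathrm{ch}^{\mathrm{out}}(x)}\deg_{\mathrm{out}}(v)^{1-1/p_{x\to c}}\,\|F_c\|_{\mathrm{out},p_{x\to c}}(v)\Big)\cdot\Big(\prod_{c\in\mathrm{ch}^{\mathrm{in}}(x)}\deg_{\mathrm{in}}(v)^{1-1/p_{c\to x}}\,\|F_c\|_{\mathrm{in},p_{c\to x}}(v)\Big).$$ In particular, applying this iteratively from the leaves to the root gives an explicit pointwise upper bound: if $B_x\equiv1$ for leaves $x$ and, for non-leaves $x$, $B_x(v)$ is defined by the right-hand side above with each $F_c$ replaced by $B_c$, then $\hom((T,o),(G,v))=F_o(v)\le B_o(v)$ for every $v\in V(G)$.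
   Context: A digraph (directed graph) is a finite directed simple loopless graph: at most one arc for each ordered pair of distinct vertices (opposite arcs are allowed). A rooted directed tree $(T,o)$ is an orientation of a finite undirected tree with a distinguished root $o$; the children of $x$ are its neighbours in the underlying tree farther from $o$ than $x$, and a leaf is a vertex with no children. $\mathrm{ch}^{\mathrm{out}}(x)$ is the set of children $c$ of $x$ with $x\to c$ an arc of $T$; $\mathrm{ch}^{\mathrm{in}}(x)$ is the set of children $c$ with $c\to x$ an arc of $T$. $\hom((T,o),(G,v))$ is the number of digraph homomorphisms $\varphi:T\to G$ (maps sending arcs to arcs, preserving direction) with $\varphi(o)=v$. $\deg_{\mathrm{in}},\deg_{\mathrm{out}}$ are in- and out-degree in $G$. For $f:V(G)\to\mathbb R_{\ge0}$: $(A_{\mathrm{out}}f)(v):=\sum_{u:\,v\to u}f(u)$, $(A_{\mathrm{in}}f)(v):=\sum_{u:\,u\to v}f(u)$, and for $p\in[1,\infty)$, $\|f\|_{\mathrm{out},p}(v):=(\sum_{u:\,v\to u}f(u)^p)^{1/p}$, $\|f\|_{\mathrm{in},p}(v):=(\sum_{u:\,u\to v}f(u)^p)^{1/p}$, sums over arcs of $G$. The message functions are defined recursively: $F_x\equiv1$ if $x$ is a leaf, and otherwise $F_x(v)=\prod_{c\in\mathrm{ch}^{\mathrm{out}}(x)}(A_{\mathrm{out}}F_c)(v)\cdot\prod_{c\in\mathrm{ch}^{\mathrm{in}}(x)}(A_{\mathrm{in}}F_c)(v)$; they satisfy $F_o(v)=\hom((T,o),(G,v))$. Empty products equal $1$ and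 $0^0=1$. *)

(* Defs.v *)
From mathcomp Require Import all_boot all_order all_algebra.
From mathcomp Require Import reals exp.

Set Implicit Arguments.
Unset Strict Implicit.
Unset Printing Implicit Defensive.

Import Order.TTheory GRing.Theory Num.Theory.

Local Open Scope ring_scope.

Record digraph := Digraph {
  vertex :> finType;
  has_arc : rel vertex;
  has_arc_irr : irreflexive has_arc }.

Arguments has_arc {_} _ _.

Section Digraph.
Variable G : digraph.
Implicit Types (u v x y : G) (n : nat).

Definition adj x y : bool := has_arc x y || has_arc y x.

Definition walk n x y : bool :=
  [exists s : n.-tuple G, path adj x s && (last x s == y)].

(* Distance in the underlying undirected graph. A shortest walk has length less
   than #|G|; for y not reachable from x the value is #|G|. *)
Definition dist x y : nat := find (fun n => walk n x y) (iota 0 #|G|).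

Definition outdeg v : nat := #|[set u | has_arc v u]|.
Definition indeg v : nat := #|[set u | has_arc u v]|.

End Digraph.

Record rooted_ditree := RootedDitree {
  ditree_digraph :> digraph;
  troot : ditree_digraph;
  ditree_oriented : forall x y : ditree_digraph, has_arc x y -> ~~ has_arc y x;
  ditree_connected : forall x y : ditree_digraph, connect (@adj _) x y;
  ditree_acyclic : forall s : seq ditree_digraph,
    (2 < size s)%N -> ~~ ucycleb (@adj _) s }.

Arguments troot : clear implicits.

Section RootedDitree.
Variable T : rooted_ditree.
Implicit Types x c : T.

Definition children x : {set T} :=
  [set c | adj x c & (dist (troot T) x < dist (troot T) c)%N].
Definition ch_out x : {set T} := [set c in children x | has_arc x c].
Definition ch_in x : {set T} := [set c in children x | has_arc c x].

Definition leaf x : bool := children x == set0.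

End RootedDitree.

Definition is_hom (T G : digraph) (phi : {ffun T -> G}) : bool :=
  [forall x, forall y, has_arc x y ==> has_arc (phi x) (phi y)].

Definition hom_count (T : rooted_ditree) (G : digraph) (v : G) : nat :=
  #|[set phi : {ffun T -> G} | is_hom phi & phi (troot T) == v]|.

Section Operators.
Variables (R : realType) (G : digraph).
Implicit Types (f : G -> R) (p : R) (v : G).

Definition A_out f v : R := \sum_(u | has_arc v u) f u.
Definition A_in f v : R := \sum_(u | has_arc u v) f u.

(* Real powers are [powR]: 0 `^ 0 = 1, and 0 `^ a = 0 for a != 0. *)
Definition norm_out p f v : R := (\sum_(u | has_arc v u) f u `^ p) `^ p^-1.
Definition norm_in p f v : R := (\sum_(u | has_arc u v) f u `^ p) `^ p^-1.

End Operators.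

Section Messages.
Variables (R : realType) (T : rooted_ditree) (G : digraph).
Implicit Types (F H : T -> G -> R) (x : T) (v : G).

(* Recursion from the leaves to the root: the value is 1 at a leaf, and
   [rhs F x] at a non-leaf x. [#|T|] rounds are enough to reach the fixed point
   when [rhs F x] depends only on F at the children of x, see [ditree_recE]. *)
Definition ditree_step (rhs : (T -> G -> R) -> T -> G -> R) F x v : R :=
  if leaf x then 1 else rhs F x v.

Definition ditree_rec (rhs : (T -> G -> R) -> T -> G -> R) : T -> G -> R :=
  iter #|T| (ditree_step rhs) (fun _ _ => 1).

Definition message_rhs F x v : R :=
  (\prod_(c in ch_out x) A_out (F c) v) * (\prod_(c in ch_in x) A_in (F c) v).

Definition message : T -> G -> R := ditree_rec message_rhs.

(* [p x y] is the exponent of the arc x -> y. *)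
Definition bound_rhs (p : T -> T -> R) F x v : R :=
  (\prod_(c in ch_out x)
     ((outdeg v)%:R `^ (1 - (p x c)^-1) * norm_out (p x c) (F c) v)) *
  (\prod_(c in ch_in x)
     ((indeg v)%:R `^ (1 - (p c x)^-1) * norm_in (p c x) (F c) v)).

Definition bound (p : T -> T -> R) : T -> G -> R := ditree_rec (bound_rhs p).

Definition child_local (rhs : (T -> G -> R) -> T -> G -> R) : Prop :=
  forall F H x v, (forall c, c \in children x -> F c =1 H c) ->
    rhs F x v = rhs H x v.

Lemma ditree_recE rhs : child_local rhs ->
  forall x v, ditree_rec rhs x v =
    if leaf x then 1 else rhs (ditree_rec rhs) x v.
Proof.
move=> loc.
pose rk x := #|[set y : T | (dist (troot T) x < dist (troot T) y)%N]|.
have rk_lt x : (rk x < #|T|)%N.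
  by rewrite -cardsT; apply/proper_card/properP; split;
    [exact: subsetT|exists x; rewrite ?inE ?ltnn].
have rk_child x c : c \in children x -> (rk c < rk x)%N.
  rewrite inE => /andP[_ xc]; apply/proper_card/properP; split.
    by apply/subsetP => y; rewrite !inE; exact: ltn_trans.
  by exists c; rewrite !inE ?ltnn.
pose it n := iter n (ditree_step rhs) (fun _ _ => 1).
have stable n : forall m x, (rk x < n)%N -> (rk x < m)%N -> it n x =1 it m x.
  elim: n => // n IHn [//|m] x xn xm v; rewrite /it !iterS /ditree_step.
  case: ifP => // _; apply: loc => c /rk_child cx.
  by apply: IHn; apply: leq_trans cx _.
move=> x v; rewrite -[RHS]/(it #|T|.+1 x v).
by apply: stable; rewrite ?leqW.
Qed.

Lemma message_rhs_local : child_local message_rhs.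
Proof.
move=> F H x v FH; congr (_ * _); apply: eq_bigr => c; rewrite inE;
  by case/andP=> /FH Fc _; apply: eq_bigr.
Qed.

Lemma bound_rhs_local p : child_local (bound_rhs p).
Proof.
rewrite /child_local /bound_rhs => F H x v FH.
have ext (Q : pred G) (q : R) (c : T) : c \in children x ->
    \sum_(u | Q u) F c u `^ q = \sum_(u | Q u) H c u `^ q.
  by move=> /FH Fc; apply: eq_bigr => u _; rewrite Fc.
by apply: (f_equal2 *%R); apply: eq_bigr => c; rewrite inE => /andP[cx _];
  rewrite /norm_out /norm_in ext.
Qed.

Lemma messageE x v :
  message x v = if leaf x then 1 else message_rhs message x v.
Proof. exact: ditree_recE message_rhs_local x v. Qed.

Lemma boundE p x v :
  bound p x v = if leaf x then 1 else bound_rhs p (bound p) x v.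
Proof. exact: ditree_recE (@bound_rhs_local p) x v. Qed.

Lemma message_ge0 x v : 0 <= message x v.
Proof.
rewrite /message /ditree_rec; elim: #|T| x v => // n IHn x v.
rewrite iterS /ditree_step; case: ifP => // _.
by apply: mulr_ge0; apply: prodr_ge0 => c _; apply: sumr_ge0.
Qed.

End Messages.

Arguments message R T G x v : clear implicits.
Arguments bound {R T} G p x v.

(* Main.v *)
Require Import Defs.
From mathcomp Require Import all_boot all_order all_algebra.
From mathcomp Require Import reals exp.

Set Implicit Arguments.
Unset Strict Implicit.
Unset Printing Implicit Defensive.

Import Order.TTheory GRing.Theory Num.Theory.

Local Open Scope ring_scope.

(** Two independent facts are combined.

    The pointwise bound is the power mean inequality: over the [n] out-neighbours
    (or in-neighbours) [u] of [v], [sum f u <= n^(1 - 1/p) (sum f u ^ p)^(1/p)]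
    for [p >= 1] ([sum_le_powR_mean]). Applied to every child of [x] and
    multiplied over the children, it compares one round of the recursion for the
    messages with one round of the recursion for the bound. The latter is
    monotone in its argument, so the comparison survives iteration
    ([message_le_bound]).

    The identity between the number of homomorphisms and the message at the root
    is elimination of leaves. Write the number of homomorphisms as a sum, over
    all maps [phi] sending the root to [v], of a product of weights in {0, 1},
    one for each arc of the tree. If [c] is a vertex of maximal depth among
    those not yet removed, the value [phi c] occurs in a single weight and in
    the message at [c]; summing over it leaves the factor contributed by [c] to
    the message at its parent. Removing all vertices but the root
    leaves the message at the root ([sum_pruned], [tree_sum]).

    To index the arcs by the non-root vertices, every such vertex must have
    exactly one parent. Two neighbours of [y], neither of them farther from the
    root than [y], are both joined to the root by walks avoiding [y]; were they
    distinct, a path between them avoiding [y] would close up to a cycle through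
    [y] ([closer_neighbour_unique]). *)

(** * The power mean inequality *)

Section PowerMean.
Variable R : realType.

(** The graph of [x `^ p / p] lies above its tangent at 1; this is Young's
    inequality for the product [x * 1]. *)
Lemma ler_powR_tangent (x p : R) : 0 <= x -> 1 <= p ->
  x <= x `^ p / p + (1 - p^-1).
Proof.
move=> x0; rewrite le_eqVlt => /predU1P[<-|p1].
  by rewrite powRr1// invr1 mulr1 subrr addr0.
have p0 : 0 < p by apply: lt_trans p1.
have q0 : 0 < 1 - p^-1 by rewrite subr_gt0 invf_lt1.
have := @conjugate_powR R x 1 p (1 - p^-1)^-1 x0 ler01 p0.
by rewrite invr_gt0 invrK mulr1 powR1 mul1r; apply=> //; rewrite addrC subrK.
Qed.

Lemma powRV (x r : R) : 0 <= x -> x^-1 `^ r = (x `^ r)^-1.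
Proof. by move=> x0; rewrite -powR_inv1// powRAC powR_inv1// powR_ge0. Qed.

(** With [M] the power mean of [f] over [P], summing the tangent inequality at
    the points [f i / M] gives [sum f i / M <= n / p + n (1 - 1/p) = n]. *)
Lemma sum_le_powR_mean (I : finType) (P : pred I) (f : I -> R) (p : R) :
  (forall i, 0 <= f i) -> 1 <= p ->
  \sum_(i | P i) f i <=
    #|[set i | P i]|%:R `^ (1 - p^-1) * (\sum_(i | P i) f i `^ p) `^ p^-1.
Proof.
move=> f0 p1; have p0 : 0 < p by apply: lt_le_trans p1.
set n := #|_|; set S := \sum_(i | P i) f i `^ p.
have S0 : 0 <= S by apply: sumr_ge0 => i _; apply: powR_ge0.
(* If the power mean vanishes, then so does f, and one cannot divide by it. *)
have [Sz|Sn0] := eqVneq S 0.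
  rewrite big1 ?mulr_ge0 ?powR_ge0// => i Pi.
  have/eqP := psumr_eq0P (fun i _ => powR_ge0 (f i) p) Sz Pi.
  by rewrite powR_eq0 => /andP[/eqP].
have Sgt : 0 < S by rewrite lt0r Sn0.
have n0 : 0 < n%:R :> R.
  rewrite ltr0n lt0n; apply: contra_neq Sn0 => /eqP; rewrite cards_eq0 => /eqP E.
  by apply: big1 => i Pi; have := in_set0 i; rewrite -E inE Pi.
pose M := (S / n%:R) `^ p^-1.
have M0 : 0 < M by rewrite powR_gt0 ?divr_gt0.
have Mp : M `^ p = S / n%:R.
  by rewrite -powRrM mulVf ?gt_eqF// powRr1// divr_ge0// ltW.
have -> : n%:R `^ (1 - p^-1) * S `^ p^-1 = n%:R * M.
  rewrite powRB; last by rewrite (gt_eqF n0) implybT.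
  rewrite powRr1 ?ltW// /M powRM ?invr_ge0 ?(ltW n0)//.
  by rewrite powRV ?ltW// -mulrA [_^-1 * _]mulrC.
have sum1 (c : R) : \sum_(i | P i) c = n%:R * c.
  by rewrite sumr_const mulr_natl; congr (_ *+ _); apply: eq_card => i; rewrite inE.
rewrite -ler_pdivrMr// mulr_suml.
have/le_trans : \sum_(i | P i) f i / M <=
    \sum_(i | P i) ((f i / M) `^ p / p + (1 - p^-1)).
  by apply: ler_sum => i _; apply: ler_powR_tangent; rewrite // divr_ge0// ltW.
apply; rewrite big_split/= sum1 -mulr_suml.
rewrite (eq_bigr (fun i => f i `^ p / (S / n%:R))); last first.
  by move=> i _; rewrite powRM ?invr_ge0 ?(ltW M0)// powRV ?(ltW M0)// Mp.
rewrite -mulr_suml -/S invf_div mulrCA mulfV// mulr1.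
by rewrite -mulrDr addrC subrK mulr1.
Qed.

End PowerMean.

(** * From the messages to the bound *)

Section MessageBound.
Variables (R : realType) (T : rooted_ditree) (G : digraph) (p : T -> T -> R).
Hypothesis p_ge1 : forall x y : T, has_arc x y -> 1 <= p x y.
Implicit Types (F H : T -> G -> R) (x c : T) (v : G).

(** This holds for an arbitrary nonnegative [F], not only for the messages: it
    is the comparison of a single round of the two recursions. *)
Lemma message_rhs_le_bound_rhs F x v : (forall c u, 0 <= F c u) ->
  message_rhs F x v <= bound_rhs p F x v.
Proof.
move=> F0; apply: ler_pM; try by apply: prodr_ge0 => c _; apply: sumr_ge0.
  apply: ler_prod => c; rewrite inE => /andP[_ xc].
  by rewrite sumr_ge0//=; apply: sum_le_powR_mean => //; apply: p_ge1.
apply: ler_prod => c; rewrite inE => /andP[_ cx].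
by rewrite sumr_ge0//=; apply: sum_le_powR_mean => //; apply: p_ge1.
Qed.

Lemma powR_sum_mono (P : pred G) (f g : G -> R) (q : R) : 1 <= q ->
    (forall u, 0 <= f u <= g u) ->
  (\sum_(u | P u) f u `^ q) `^ q^-1 <= (\sum_(u | P u) g u `^ q) `^ q^-1.
Proof.
move=> q1 fg; have q0 : 0 <= q by apply: le_trans q1.
have S0 (h : G -> R) : 0 <= \sum_(u | P u) h u `^ q.
  by apply: sumr_ge0 => u _; apply: powR_ge0.
apply: ge0_ler_powR; rewrite ?invr_ge0 ?nnegrE//.
apply: ler_sum => u _; have /andP[f0 fgu] := fg u.
by apply: ge0_ler_powR; rewrite // nnegrE// (le_trans f0).
Qed.

Lemma bound_rhs_mono F H x v : (forall c u, 0 <= F c u <= H c u) ->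
  bound_rhs p F x v <= bound_rhs p H x v.
Proof.
have prod0 := @mulr_ge0 R _ _ (powR_ge0 _ _) (powR_ge0 _ _).
move=> FH; apply: ler_pM; try by apply: prodr_ge0 => c _; apply: prod0.
  apply: ler_prod => c; rewrite inE => /andP[_ /p_ge1 xc].
  by rewrite prod0 ler_wpM2l ?powR_ge0 ?powR_sum_mono.
apply: ler_prod => c; rewrite inE => /andP[_ /p_ge1 cx].
by rewrite prod0 ler_wpM2l ?powR_ge0 ?powR_sum_mono.
Qed.

(** Both sides are [#|T|]-fold iterates started at 1, so that the induction is on
    the number of rounds. Each round passes through the bound of the messages,
    and then replaces them by their own bounds. Nonnegativity is carried along
    because the single-round comparison needs it. *)
Lemma message_le_bound x v : message R T G x v <= bound G p x v.
Proof.
suff /(_ x v)/andP[] : forall x v, 0 <= message R T G x v <= bound G p x v by [].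
rewrite /message /bound /ditree_rec; elim: #|T| => [|n IHn] y u /=.
  by rewrite ler01 lexx.
rewrite /ditree_step; case: ifP => _; first by rewrite ler01 lexx.
have F0 c w : 0 <= iter n (ditree_step (@message_rhs R T G)) (fun _ _ => 1) c w.
  by have /andP[] := IHn c w.
apply/andP; split.
  by apply: mulr_ge0; apply: prodr_ge0 => c _; apply: sumr_ge0.
exact: le_trans (message_rhs_le_bound_rhs _ _ F0) (bound_rhs_mono _ _ IHn).
Qed.

End MessageBound.

(** * Summation over a tree by elimination of leaves *)

(** The tree is given by a parent function on the vertices other than the root
    [o], with a rank that decreases towards the root. *)
Section TreeSum.
Variables (R : comNzRingType) (T V : finType) (o : T) (par : T -> T).
Variables (rk : T -> nat) (a : T -> V -> V -> R) (F : T -> V -> R) (v : V).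
Hypothesis rk_par : forall c, c != o -> (rk (par c) < rk c)%N.
Hypothesis F_rec : forall x u,
  F x u = \prod_(c | (c != o) && (par c == x)) \sum_w a c u w * F c w.
Implicit Types (phi : {ffun T -> V}) (A : {set T}) (c : T).

Definition update phi c u : {ffun T -> V} :=
  [ffun y => if y == c then u else phi y].

(** Maps defined on [A] only are represented by total maps with the default value
    [v] elsewhere. Since [v] is also the value prescribed at the root, the root
    is one of the vertices outside [A] and gets no special treatment. *)
Definition free_on A phi := [forall y, (y \notin A) ==> (phi y == v)].

(** The bijection behind the summation over the value at [c]: a map free on [A]
    is a map free on [A :\ c] together with its value at [c]. *)
Lemma sum_free_on_update A c (K : {ffun T -> V} -> R) : c \in A ->
  \sum_(phi | free_on A phi) K phi =
  \sum_(phi | free_on (A :\ c) phi) \sum_u K (update phi c u).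
Proof.
move=> cA; rewrite (pair_big _ xpredT)/=.
rewrite (reindex_onto (fun q : {ffun T -> V} * V => update q.1 c q.2)
           (fun phi => (update phi c v, phi c))) /=; last first.
  by move=> phi _; apply/ffunP => y; rewrite !ffunE; case: eqP => // ->.
apply: eq_bigl => -[phi u] /=; rewrite andbT.
apply/andP/forallP => [[/forallP fr /eqP[E _]] y|fr].
  apply/implyP; rewrite !inE negb_and negbK => yAc.
  rewrite -E !ffunE; case: eqP yAc => //= ync yA.
  by have := fr y; rewrite yA ffunE; case: (y =P c) ync.
split.
  apply/forallP => y; apply/implyP => yA; rewrite ffunE.
  case: (y =P c) => [yc|_]; first by rewrite yc cA in yA.
  by have := fr y; rewrite !inE (negPf yA) andbF.
apply/eqP; congr pair; last by rewrite ffunE eqxx.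
apply/ffunP => y; rewrite !ffunE; case: eqP => // ->.
by have := fr c; rewrite !inE eqxx => /eqP.
Qed.

(** The factor of the edge above [c] when only [o] and the vertices of [A] are
    left: the weight of the edge if [c] is still there, the contribution of [c]
    to the message at its parent if the parent is still there, and nothing if
    the parent has been removed too, [c] being then accounted for in the
    messages of its ancestors. *)
Definition pruned_factor A phi c : R :=
  if c \in A then a c (phi (par c)) (phi c)
  else if par c \in o |: A then \sum_w a c (phi (par c)) w * F c w
  else 1.

(** The sum does not change when a vertex [c] of maximal rank in [A] is removed:
    the children of [c] lie outside [A], their factors multiply to [F c (phi c)],
    and summing this against the weight of the edge above [c] gives the factor
    of [c] with respect to [A :\ c]. For empty [A] the remaining factors are those
    of the children of the root. *)
Lemma sum_pruned A : o \notin A -> (forall c, c \in A -> par c \in o |: A) ->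
  \sum_(phi | free_on A phi) \prod_(c | c != o) pruned_factor A phi c = F o v.
Proof.
elim: {A}_.+1 {-2}A (ltnSn #|A|) => // n IHn A An oA parA.
have [->|[c0 c0A]] := set_0Vmem A.
  rewrite (big_pred1 [ffun=> v]); last first.
    move=> phi /=; apply/forallP/eqP => [fr|-> y]; last first.
      by rewrite ffunE eqxx implybT.
    by apply/ffunP => y; have := fr y; rewrite inE ffunE => /eqP.
  rewrite F_rec (bigID (fun c => par c == o))/= [X in _ * X]big1 ?mulr1.
    apply: eq_bigr => c /andP[_ /eqP co].
    by rewrite /pruned_factor in_set0 co setU0 set11 ffunE.
  by move=> c /andP[_ co]; rewrite /pruned_factor in_set0 setU0 inE (negPf co).
have [c cA cmax] : exists2 c, c \in A & forall d, d \in A -> (rk d <= rk c)%N.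
  by case: (arg_maxnP rk c0A) => c; exists c.
have nco : c != o by apply: contraNneq oA => <-.
have childN d : d != o -> par d == c -> d \notin A.
  move=> dno /eqP dc; apply/negP => /cmax; apply/negP.
  by rewrite -ltnNge -dc rk_par.
have parNc : par c != c by apply/eqP => E; have := rk_par nco; rewrite E ltnn.
have parU d : par d != c -> (par d \in o |: (A :\ c)) = (par d \in o |: A).
  by move=> dc; rewrite !inE dc.
rewrite (sum_free_on_update _ cA) -[RHS](IHn (A :\ c)).
- apply: eq_bigr => phi _.
  rewrite [RHS](bigD1 c)//= [X in _ = X * _]/pruned_factor setD11 parU// parA// mulr_suml.
  apply: eq_bigr => u _.
  rewrite (bigD1 c)//= [X in X * _ = _]/pruned_factor cA !ffunE eqxx (negPf parNc) -mulrA.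
  congr (_ * _); rewrite (bigID (fun d => par d == c))/=.
  rewrite [X in _ = _ * X](bigID (fun d => par d == c))/=.
  rewrite [X in _ = _ * (X * _)]big1 ?mul1r.
    congr (_ * _).
      (* The factors of the children of c make up the message at c. *)
      rewrite F_rec; apply: eq_big => [d|d /andP[/andP[dno _] dc]].
        by case: eqP => //= _; case: (d =P c) => [->|]//; rewrite (negPf parNc).
      rewrite /pruned_factor (negPf (childN _ _ _))//.
      by rewrite ffunE dc (eqP dc) !inE cA orbT.
    (* The edges that do not touch c keep their factors. *)
    apply: eq_bigr => d /andP[/andP[dno dnc] dc].
    by rewrite /pruned_factor parU// !inE dnc /= !ffunE (negPf dc) (negPf dnc).
  move=> d /andP[/andP[dno dnc] dc].
  rewrite /pruned_factor !inE (negPf (childN _ _ _))// andbF (eqP dc).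
  by rewrite eqxx (negPf nco).
- by rewrite (cardsD1 c) cA in An.
- by rewrite !inE (negPf oA) andbF.
- move=> d; rewrite 2!inE => /andP[dnc dA].
  have dno : d != o by apply: contraNneq oA => <-.
  by rewrite parU ?parA//; apply: contraL dA; apply: childN.
Qed.

Lemma tree_sum :
  \sum_(phi : {ffun T -> V} | phi o == v)
     \prod_(c | c != o) a c (phi (par c)) (phi c) = F o v.
Proof.
rewrite -(@sum_pruned [set~ o]) ?setC11//; last first.
  by move=> c _; rewrite !inE orbN.
apply: eq_big => [phi|phi _].
  apply/idP/forallP => [/eqP <- y|/(_ o)]; last by rewrite setC11.
  by rewrite !inE negbK; apply/implyP => /eqP ->.
by apply: eq_bigr => c co; rewrite /pruned_factor !inE co.
Qed.

End TreeSum.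

(** * Parents in a rooted tree *)

Section Parents.
Variable T : rooted_ditree.
Implicit Types x y z c : T.

Local Notation o := (troot T).
Local Notation d := (dist o).

Lemma adj_sym : symmetric (@adj T).
Proof. by move=> x y; rewrite /adj orbC. Qed.

Lemma adj_irr x : adj x x = false.
Proof. by rewrite /adj has_arc_irr. Qed.

Lemma dist_root : d o = 0%N.
Proof.
have : (0 < #|T|)%N by apply/card_gt0P; exists o.
rewrite /dist; case: #|T| => //= n _.
by rewrite ifT//; apply/existsP; exists [tuple]; rewrite /= eqxx.
Qed.

Lemma dist_le_walk n y : walk n o y -> (d y <= n)%N.
Proof.
move=> wn; rewrite leqNgt; apply/negP => nd.
have := before_find 0%N nd; rewrite nth_iota ?wn//.
by rewrite (leq_trans nd)// -[#|T|](size_iota 0) find_size.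
Qed.

Lemma dist_walk y : walk (d y) o y.
Proof.
have hasw : has (fun n => walk n o y) (iota 0 #|T|).
  have /connectP[s0 s0P ->] := ditree_connected o y.
  case/shortenP: s0P => s sP us _; apply/hasP; exists (size s).
    rewrite mem_iota add0n /=; have := max_card (mem (o :: s)).
    by rewrite (card_uniqP us).
  by apply/existsP; exists (in_tuple s); rewrite sP eqxx.
have := nth_find 0%N hasw; rewrite nth_iota//.
by move: hasw; rewrite has_find size_iota.
Qed.

(** The vertex before [y] on a shortest walk from the root. *)
Lemma ex_closer_neighbour y : y != o -> exists2 x, adj x y & (d x < d y)%N.
Proof.
move=> yo; have /existsP[[s /= /eqP sz] /andP[sP /eqP sl]] := dist_walk y.
case/lastP: s => [|s z] in sz sP sl; first by rewrite -sl eqxx in yo.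
move: sP sl; rewrite rcons_path last_rcons size_rcons in sz * => /andP[sP adjz] zy.
exists (last o s); first by rewrite -zy.
rewrite -sz ltnS; apply: dist_le_walk.
by apply/existsP; exists (in_tuple s); rewrite sP eqxx.
Qed.

(** All vertices before the last one of a shortest walk to [x] are closer to the
    root than [x], hence closer than [y], hence different from [y]. *)
Lemma connect_avoiding y x : x != y -> (d x <= d y)%N ->
  connect (fun u w => [&& adj u w, u != y & w != y]) o x.
Proof.
elim: {x}_.+1 {-2}x (ltnSn (d x)) => // n IHn x dx xy xled.
have [->|xo] := eqVneq x o; first exact: connect0.
have [z zx zd] := ex_closer_neighbour xo.
have zy : z != y by apply: contraTneq zd => ->; rewrite -leqNgt.
apply: (connect_trans (y := z)); last by apply: connect1; apply/and3P.
by apply: IHn => //; [apply: leq_trans zd _|apply: leq_trans (ltnW zd) _].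
Qed.

(** Acyclicity enters only here. The non-strict inequalities make the lemma
    exclude also an edge between two vertices at the same distance from the
    root: one of them would be a second such neighbour besides the
    parent of the other. *)
Lemma closer_neighbour_unique y x1 x2 : adj x1 y -> adj x2 y ->
  (d x1 <= d y)%N -> (d x2 <= d y)%N -> x1 = x2.
Proof.
move=> a1 a2 d1 d2.
have neq x : adj x y -> x != y by apply: contraTneq => ->; rewrite adj_irr.
set e := (fun u w => [&& adj u w, u != y & w != y]).
have e_sym : symmetric e.
  by move=> u w; rewrite /e adj_sym; congr (_ && _); rewrite andbC.
have : connect e x1 x2.
  apply: (@connect_trans _ _ o); last exact: connect_avoiding (neq _ a2) d2.
  by rewrite (sym_connect_sym e_sym); apply: connect_avoiding (neq _ a1) d1.
(* A simple path from x1 to x2 avoiding y; adding y to it gives a cycle, of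
   length at least 3 because x1 and x2 differ. *)
case/connectP => s0 s0P x2E; move: a2; rewrite x2E {d2 x2E}.
case/shortenP: s0P => s sP us _ a2.
case: s => [|z s] in sP us a2 *; first by [].
have := @ditree_acyclic T (y :: x1 :: z :: s) isT.
have adjs : path (@adj T) x1 (z :: s).
  by apply: sub_path sP => u w /and3P[].
have yNs : y \notin x1 :: z :: s.
  rewrite inE negb_or eq_sym neq//=.
  have : all (fun w => w != y) (z :: s).
    elim: {us a2 adjs} (z :: s) (x1) sP => //= w r IHr u /andP[/and3P[_ _ ->]].
    exact: IHr.
  by move/allP => al; apply/negP => /al; rewrite eqxx.
move/negP; case; rewrite /ucycleb cons_uniq yNs us.
by rewrite andbT /cycle rcons_path a2 !andbT /= -/(adj y x1) adj_sym a1.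
Qed.

Definition parent y : T := odflt o [pick x | y \in children x].

Lemma in_children x y : (y \in children x) = (y != o) && (parent y == x).
Proof.
have childP z : y \in children z -> adj z y /\ (d z <= d y)%N.
  by rewrite inE => /andP[-> /ltnW].
apply/idP/andP => [yx|[yo /eqP <-]]; last first.
  rewrite /parent; case: pickP => [//|/= no].
  have [z zy zd] := ex_closer_neighbour yo.
  by have := no z; rewrite inE zy zd.
split.
  by move: yx; rewrite inE => /andP[_]; apply: contraTneq => ->; rewrite dist_root.
rewrite /parent; case: pickP => [z yz|/(_ x)]; last by rewrite yx.
have [az dz] := childP _ yz; have [ax dx] := childP _ yx.
exact/eqP/(closer_neighbour_unique az ax).
Qed.

Lemma parent_child y : y != o -> y \in children (parent y).
Proof. by move=> yo; rewrite in_children yo eqxx. Qed.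

Lemma dist_parent y : y != o -> (d (parent y) < d y)%N.
Proof. by move/parent_child; rewrite inE => /andP[]. Qed.

(** Every edge joins a parent and a child, so that the edges above the non-root
    vertices are all the edges. *)
Lemma adj_child x y : adj x y -> (y \in children x) || (x \in children y).
Proof.
move=> xy; rewrite !inE xy adj_sym xy /=.
case: ltngtP => // dxy; have [yo|yo] := eqVneq y o; last first.
  have [z zy zd] := ex_closer_neighbour yo.
  have := closer_neighbour_unique zy xy (ltnW zd); rewrite dxy leqnn => /(_ isT) zx.
  by rewrite zx dxy ltnn in zd.
have [xo|xo] := eqVneq x o; first by rewrite xo yo adj_irr in xy.
have [z _] := ex_closer_neighbour xo.
by rewrite dxy yo dist_root.
Qed.

End Parents.

(** * Homomorphisms and the message at the root *)

Section HomCount.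
Variables (T : rooted_ditree) (G : digraph).

(** The condition that a homomorphism with value [u] at the parent of [c] and [w]
    at [c] has to satisfy; the orientation of the arc between them decides which
    way round it is. *)
Definition arc_weight (c : T) (u w : G) : bool :=
  if has_arc (parent c) c then has_arc u w else has_arc w u.

Lemma is_hom_parent (phi : {ffun T -> G}) :
  is_hom phi =
  [forall (c | c != troot T), arc_weight c (phi (parent c)) (phi c)].
Proof.
have no_both (x y : T) : has_arc x y -> has_arc y x = false.
  by move/ditree_oriented/negPf.
apply/forallP/forall_inP => [hom c co|w x].
  have := parent_child co; rewrite inE => /andP[/orP ad _].
  rewrite /arc_weight; case: ifP => pc.
    by have /forallP/(_ c) := hom (parent c); rewrite pc.
  case: ad; first by rewrite pc.
  by have /forallP/(_ (parent c)) := hom c => /implyP h /h.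
apply/forallP => y; apply/implyP => xy.
have /adj_child/orP[] : adj x y by rewrite /adj xy.
  rewrite in_children => /andP[yo /eqP px].
  by have := w _ yo; rewrite /arc_weight px xy.
rewrite in_children => /andP[xo /eqP py].
by have := w _ xo; rewrite /arc_weight py (no_both _ _ xy).
Qed.

(** The out-children and in-children of [x] are merged into a single product, in
    the form required by [tree_sum]; at a leaf the product is empty. *)
Lemma message_parent (R : realType) (x : T) (u : G) :
  message R T G x u =
  \prod_(c | (c != troot T) && (parent c == x))
     \sum_w (arc_weight c u w)%:R * message R T G c w.
Proof.
rewrite -(eq_bigl _ _ (in_children x)) messageE; case: ifP => [/eqP ->|_].
  by rewrite big_set0.
rewrite /message_rhs [RHS](bigID (fun c => has_arc x c))/=.
have arcE c : c \in children x -> has_arc c x = ~~ has_arc x c.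
  rewrite inE => /andP[/orP[] xc _].
    by rewrite xc; apply/negbTE/ditree_oriented.
  by rewrite xc ditree_oriented.
have sumE (P : pred G) c : \sum_(w | P w) message R T G c w =
    \sum_w (P w)%:R * message R T G c w.
  by rewrite big_mkcond; apply: eq_bigr => w _; case: (P w); rewrite (mul1r, mul0r).
congr (_ * _); apply: eq_big => c.
- by rewrite inE.
- rewrite inE => /andP[cx xc]; rewrite /A_out sumE.
  move: cx; rewrite in_children => /andP[_ /eqP px].
  by apply: eq_bigr => w _; rewrite /arc_weight px xc.
- by rewrite inE; case cx: (_ \in _); rewrite //= arcE.
- rewrite inE => /andP[cx xc]; rewrite /A_in sumE.
  rewrite (arcE _ cx) in xc.
  move: cx; rewrite in_children => /andP[_ /eqP px].
  by apply: eq_bigr => w _; rewrite /arc_weight px (negPf xc).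
Qed.

Lemma hom_count_message (R : realType) (v : G) :
  (hom_count T v)%:R = message R T G (troot T) v.
Proof.
rewrite -(tree_sum v (@dist_parent T) (@message_parent R)).
rewrite /hom_count -sum1_card natr_sum big_mkcond [RHS]big_mkcond /=.
apply: eq_bigr => phi _; rewrite inE is_hom_parent andbC.
case: eqP => //= _; case: forall_inP => [w|w].
  by rewrite big1// => c co; rewrite w.
apply/esym/eqP/prodf_eq0.
have /existsP[c] :
    [exists c, (c != troot T) && ~~ arc_weight c (phi (parent c)) (phi c)].
  rewrite -negb_forall_in; exact/forall_inP.
by case/andP => co nw; exists c => //; rewrite (negPf nw).
Qed.

End HomCount.

Theorem proposition4p4 (R : realType) (T : rooted_ditree) (G : digraph)
    (p : T -> T -> R) (hp : forall x y : T, has_arc x y -> 1 <= p x y) :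
  (forall (v : G) (x : T), ~~ leaf x ->
     message R T G x v <= bound_rhs p (message R T G) x v) /\
  (forall v : G,
     (hom_count T v)%:R = message R T G (troot T) v /\
     message R T G (troot T) v <= bound G p (troot T) v).
Proof.
split=> [v x nleaf|v]; last first.
  by split; [exact: hom_count_message|exact: message_le_bound].
rewrite messageE (negPf nleaf); apply: message_rhs_le_bound_rhs => //.
exact: message_ge0.
Qed.
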